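(* Let $0<T_{min}\le T_{max}<\infty$ and assume that there exist matrices $P_i\in\mathbb{S}^{n+m}_{\succ0}$, $i=1,\ldots,N$, and a nonnegative matrix $\Pi=[\pi_{ij}]\in\mathbb{R}^{N\times N}$ verifying $\mathbf{1}_N^T\Pi=\mathbf{1}_N^T$ such that the condition $$e^{\bar A_i^T\theta}\left(\sum_{j=1}^N\pi_{ji}\bar J_{j,i}^TP_j\bar J_{j,i}\right)e^{\bar A_i\theta}-P_i\prec0$$ holds for all $i=1,\ldots,N$ and all $\theta\in[T_{min},T_{max}]$. Then the switched impulsive system with sampled-data state-feedback $$\begin{array}{rcl}\dot{x}(t)&=&A_{\sigma(t)}x(t)+B_{\sigma(t)}u(t),\ t\in\mathbb{R}_{\ge0}\backslash\{t_k\}_{k=0}^\infty\\ u(t)&=&K_{\sigma(t_k^+),\sigma(t_k)}^1x(t_k)+K_{\sigma(t_k^+),\sigma(t_k)}^2u(t_k),\ t\in(t_k,t_{k+1}]\\ x(t_k^+)&=&J_{\sigma(t_k^+),\sigma(t_k)}x(t_k),\ k\in\mathbb{Z}_{\ge0}\end{array}$$ controlled with the min-jumping rule $$\sigma(t_k^+)=\operatorname*{arg\,min}_{j\in\{1,\ldots,N\}}\left\{\chi(t_k)^T\bar J_{j,\sigma(t_k)}^TP_j\bar J_{j,\sigma(t_k)}\chi(t_k)\right\},\qquad \chi:=\begin{bmatrix}x\\ u\end{bmatrix},$$ is asymptotically stable for any sequence $\{t_k\}_{k=0}^\infty$ satisfying the range dwell-time condition $t_{k+1}-t_k\in[T_{min},T_{max}]$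 for all $k\in\mathbb{Z}_{\ge0}$.
   Context: $\mathbb{S}^{q}$ is the set of real symmetric $q\times q$ matrices, $\mathbb{S}^{q}_{\succ0}$ the positive definite ones; $X\prec0$ means negative definite. $\mathbf{1}_N$ is the $N$-vector of ones. A nonnegative matrix is a matrix with nonnegative entries. Data: integers $n,m,N\ge1$ and real matrices $A_i\in\mathbb{R}^{n\times n}$, $B_i\in\mathbb{R}^{n\times m}$, $J_{j,i}\in\mathbb{R}^{n\times n}$, $K_{j,i}^1\in\mathbb{R}^{m\times n}$, $K_{j,i}^2\in\mathbb{R}^{m\times m}$, $i,j=1,\ldots,N$. Trajectories are left-continuous: $x(t_k)=\lim_{s\uparrow t_k}x(s)$ and $x(t_k^+):=\lim_{s\downarrow t_k}x(s)$ (similarly for $u$, $\sigma$). The signal $\sigma:\mathbb{R}_{\ge0}\to\{1,\ldots,N\}$ is piecewise constant and only changes value at the instants $t_k$ (it is constant on each $(t_k,t_{k+1}]$). In the rule, if the minimizer is not unique, any minimizer may be chosen. With $\chi=\mathrm{col}(x,u)$ the system is equivalently written as $\dot\chi(t)=\bar A_{\sigma(t)}\chi(t)$ for $t\notin\{t_k\}$ and $\chi(t_k^+)=\bar J_{\sigma(t_k^+),\sigma(t_k)}\chi(t_k)$, where $$\bar A_i=\begin{bmatrix}A_i&B_i\\ 0&0\end{bmatrix},\qquad \bar J_{j,i}=\begin{bmatrix}J_{j,i}&0\\ K_{j,i}^1&K_{j,i}^2\end{bmatrix}.$$ Asymptotic stability is understood in the usual sense for the zero solution of this (augmented) system: Lyapunov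 stability and convergence of $\chi(t)$ to $0$ as $t\to\infty$. *)

(* Defs.v *)
From HB Require Import structures.
From mathcomp Require Import all_boot all_order all_algebra.
From mathcomp Require Import all_classical all_reals all_analysis.

Set Implicit Arguments.
Unset Strict Implicit.
Unset Printing Implicit Defensive.

Import Order.TTheory GRing.Theory Num.Theory.
Import numFieldNormedType.Exports.

Local Open Scope classical_set_scope.
Local Open Scope ring_scope.

Definition quad_form (R : realType) (q : nat) (M : 'M[R]_q) (v : 'cV[R]_q) : R :=
  (v^T *m M *m v) ord0 ord0.

Definition posdefmx (R : realType) (q : nat) (M : 'M[R]_q) : Prop :=
  M^T = M /\ forall v : 'cV[R]_q, v != 0 -> 0 < quad_form M v.

Definition negdefmx (R : realType) (q : nat) (M : 'M[R]_q) : Prop :=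
  M^T = M /\ forall v : 'cV[R]_q, v != 0 -> quad_form M v < 0.

Definition expmx (R : realType) (q : nat) (M : 'M[R]_q) : 'M[R]_q :=
  limn (series (fun k : nat => k`!%:R^-1 *: M ^+ k)).

Definition is_argmin (R : realType) (I : Type) (f : I -> R) (j : I) : Prop :=
  forall i : I, f j <= f i.

Section SwitchedImpulsiveSystem.

Variables (R : realType) (n m N : nat).
Variables (A : 'I_N -> 'M[R]_n) (B : 'I_N -> 'M[R]_(n, m)).
Variables (J : 'I_N -> 'I_N -> 'M[R]_n).
Variables (K1 : 'I_N -> 'I_N -> 'M[R]_(m, n)) (K2 : 'I_N -> 'I_N -> 'M[R]_m).
Variable P : 'I_N -> 'M[R]_(n + m).

Definition Abar (i : 'I_N) : 'M[R]_(n + m) := block_mx (A i) (B i) 0 0.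

Definition Jbar (j i : 'I_N) : 'M[R]_(n + m) :=
  block_mx (J j i) 0 (K1 j i) (K2 j i).

Definition aug (x : R -> 'cV[R]_n) (u : R -> 'cV[R]_m) (s : R) : 'cV[R]_(n + m) :=
  col_mx (x s) (u s).

(* Functions are total on R; only their values on [0, +oo[ are constrained.
   The mode [j] below is sigma(t_k^+): sigma equals j on the whole of
   ]t_k, t_{k+1}].  Before t_0 (when t_0 > 0) no impulse has occurred, so
   sigma and the sampled input u keep their initial values. *)
Record min_jumping_trajectory (t : nat -> R)
    (x : R -> 'cV[R]_n) (u : R -> 'cV[R]_m) (sigma : R -> 'I_N) : Prop := {
  traj_init : forall s : R, 0 <= s <= t 0%N -> sigma s = sigma 0 /\ u s = u 0;
  traj_left_continuous : forall s : R, 0 < s -> x r @[r --> s^'-] --> x s;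
  traj_flow : forall s : R, 0 < s -> (forall k : nat, s <> t k) ->
    is_derive s (1 : R) x (A (sigma s) *m x s + B (sigma s) *m u s);
  (* the differential equation at s = 0, with a one-sided derivative *)
  traj_flow0 : 0 < t 0%N ->
    h^-1 *: (x h - x 0) @[h --> 0^'+] -->
      A (sigma 0) *m x 0 + B (sigma 0) *m u 0;
  traj_jump : forall k : nat, exists j : 'I_N,
    [/\ forall s : R, t k < s <= t k.+1 -> sigma s = j,
        forall s : R, t k < s <= t k.+1 ->
          u s = K1 j (sigma (t k)) *m x (t k) + K2 j (sigma (t k)) *m u (t k),
        x s @[s --> (t k)^'+] --> J j (sigma (t k)) *m x (t k)
      & is_argmin
          (fun l : 'I_N => quad_form
             ((Jbar l (sigma (t k)))^T *m P l *m Jbar l (sigma (t k)))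
             (aug x u (t k))) j]
}.

Definition min_jumping_solutions (t : nat -> R) : set (R -> 'cV[R]_(n + m)) :=
  [set chi | exists x u sigma,
     min_jumping_trajectory t x u sigma /\ chi = aug x u].

End SwitchedImpulsiveSystem.

(* `|_| on column vectors is the max norm, equivalent to the Euclidean one. *)
Definition asymptotically_stable (R : realType) (q : nat)
    (S : set (R -> 'cV[R]_q)) : Prop :=
  (forall eps : R, 0 < eps -> exists2 delta : R, 0 < delta &
     forall chi, S chi -> `|chi 0| < delta ->
       forall s : R, 0 <= s -> `|chi s| < eps) /\
  (forall chi, S chi -> chi s @[s --> +oo] --> (0 : 'cV[R]_q)).

(* Main.v *)
(* Between impulses the augmented state flows by [expmx ((s - t_k) *: Abar)].
   Let [V_k] be the value of the quadratic form [P_{sigma(t_k^+)}] at the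
   post-impulse state [chi(t_k^+)].  The minimum defining the jumping rule at
   [t_{k+1}] is at most the average with weights [Pi j i], which by the LMI is
   less than [V_k].  The quadratic form of the LMI is continuous and negative on
   the compact set [Tmin, Tmax] x (unit sphere), so the decrease is uniform:
   [V_{k+1} <= rho * V_k] with [rho < 1].  As the flow is bounded over a dwell
   time, [chi] decays geometrically. *)
Require Import Defs.
From HB Require Import structures.
From mathcomp Require Import all_boot all_order all_algebra.
From mathcomp Require Import all_classical all_reals all_analysis.
From mathcomp Require Import lra ring.

Set Implicit Arguments.
Unset Strict Implicit.
Unset Printing Implicit Defensive.

Import Order.TTheory GRing.Theory Num.Theory.
Import numFieldNormedType.Exports.

Local Open Scope classical_set_scope.
Local Open Scope ring_scope.

(** * Max norm, entrywise limits and entrywise derivatives of matrices *)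

Section MatrixNorm.
Variable R : realType.

Lemma ler_mx_entry (p q : nat) (M : 'M[R]_(p, q)) i j : `|M i j| <= `|M|.
Proof. by rewrite [leRHS]/Num.norm/= mx_normrE; exact: (le_bigmax _ _ (i, j)). Qed.

Lemma mx_norm_le (p q : nat) (M : 'M[R]_(p, q)) (c : R) :
  0 <= c -> (forall i j, `|M i j| <= c) -> `|M| <= c.
Proof.
move=> c0 Mc; rewrite [leLHS]/Num.norm/= mx_normrE.
by apply: bigmax_le => // -[i j] _; exact: Mc.
Qed.

(** The max norm is not submultiplicative: an entry of the product is a sum of [q] terms, whence the
    factor [q%:R]. *)
Lemma mx_norm_mulmx (p q r : nat) (M : 'M[R]_(p, q)) (L : 'M[R]_(q, r)) :
  `|M *m L| <= q%:R * (`|M| * `|L|).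
Proof.
apply: mx_norm_le => [|i j]; first by rewrite !mulr_ge0.
rewrite mxE; apply: le_trans (ler_norm_sum _ _ _) _.
have -> : q%:R * (`|M| * `|L|) = \sum_(k < q) `|M| * `|L|.
  by rewrite sumr_const card_ord mulr_natl.
by apply: ler_sum => k _; rewrite normrM ler_pM ?ler_mx_entry.
Qed.

Lemma mx_norm_tr (p q : nat) (M : 'M[R]_(p, q)) : `|M^T| = `|M|.
Proof.
apply/eqP; rewrite eq_le !mx_norm_le // => i j; last first.
  by rewrite mxE ler_mx_entry.
by have := ler_mx_entry M^T j i; rewrite mxE.
Qed.

Lemma cvg_mxP (T : Type) (F : set_system T) {FF : Filter F} (p q : nat)
    (f : T -> 'M[R]_(p, q)) (l : 'M[R]_(p, q)) :
  f @ F --> l <-> (forall i j, (fun x => f x i j) @ F --> l i j).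
Proof.
split=> [fl i j|fl].
  pose g (M : 'M[R]_(p, q)) := M i j.
  have gl : g @ l --> g l by exact: coord_continuous.
  exact: (cvg_comp f g fl gl).
apply/cvgrPdist_le => /= e e0.
(* There are finitely many entries, so their eventual bounds hold simultaneously. *)
suff : \forall x \near F, forall ij : 'I_p * 'I_q, `|l ij.1 ij.2 - f x ij.1 ij.2| <= e.
  apply: filterS => x fx; apply: mx_norm_le (ltW e0) _ => i j.
  by rewrite !mxE; exact: (fx (i, j)).
apply: filter_forall => -[i j] /=.
by move: (fl i j) => /cvgrPdist_le; apply.
Qed.

Lemma cvg_mulmx (T : Type) (F : set_system T) {FF : Filter F} (p q r : nat)
    (f : T -> 'M[R]_(p, q)) (g : T -> 'M[R]_(q, r)) (l : 'M[R]_(p, q)) (k : 'M[R]_(q, r)) :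
  f @ F --> l -> g @ F --> k -> f x *m g x @[x --> F] --> l *m k.
Proof.
move=> /cvg_mxP fl /cvg_mxP gk; apply/cvg_mxP => i j.
rewrite mxE; under eq_fun do rewrite mxE.
by apply: cvg_big => [|h _]; [exact: add_continuous | exact: cvgM].
Qed.

Lemma is_derive_mxP (p q : nat) (f : R -> 'M[R]_(p, q)) (s : R) df :
  is_derive s (1 : R) f df <->
  forall i j, is_derive s (1 : R) (fun x => f x i j) (df i j).
Proof.
split=> [[fd <-] i j|fd].
  have /derivable_mxP fd' := fd.
  by apply: DeriveDef => //; rewrite derive_mx // mxE.
have fd' : derivable f s 1.
  by apply/derivable_mxP => i j; have [] := fd i j.
apply: DeriveDef => //; rewrite derive_mx //; apply/matrixP => i j.
by rewrite mxE; have [] := fd i j.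
Qed.

Lemma is_derive_mulmx (p q r : nat) (f : R -> 'M[R]_(p, q))
    (g : R -> 'M[R]_(q, r)) (s : R) df dg :
  is_derive s (1 : R) f df -> is_derive s (1 : R) g dg ->
  is_derive s (1 : R) (fun x => f x *m g x) (df *m g s + f s *m dg).
Proof.
move=> /is_derive_mxP fd /is_derive_mxP gd; apply/is_derive_mxP => i j.
have -> : (fun x => (f x *m g x) i j) =
    \sum_(k < q) ((fun x => f x i k) * (fun x => g x k j)).
  by apply/funext => x; rewrite mxE fct_sumE.
apply: (is_derive_eq (is_derive_sum (fun k => is_deriveM (fd i k) (gd k j)))).
rewrite !mxE -big_split /=; apply: eq_bigr => k _.
by rewrite addrC; congr (_ + _); rewrite [LHS]mulrC.
Qed.

(** The mean value theorem is applied to each entry between [x] and [y], strictly inside the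
    interval, so nothing is asked at [a] and [b]. *)
Lemma derive0_mx_cst (p q : nat) (f : R -> 'M[R]_(p, q)) (a b x y : R) :
  (forall s, a < s < b -> is_derive s (1 : R) f 0) ->
  a < x < b -> a < y < b -> f x = f y.
Proof.
move=> fd.
wlog xy : x y / x <= y => [H xab yab|/andP[ax xb] /andP[ay yb]].
  by case: (leP x y) => [/H|/ltW /H] -> .
apply/matrixP => i j; apply/eqP; rewrite eq_sym -subr_eq0; apply/eqP.
have fd' s : a < s < b -> is_derive s (1 : R) (fun x => f x i j) 0.
  by move=> /fd /is_derive_mxP /(_ i j); rewrite mxE.
have [||c _ ->] := @MVT_segment R (fun x => f x i j) (fun=> 0) x y xy.
- move=> s; rewrite in_itv/= => /andP[xs sy]; apply: fd'.
  by rewrite (lt_trans ax xs) (lt_trans sy yb).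
- apply: derivable_within_continuous => s; rewrite in_itv/= => /andP[xs sy].
  by have [] := fd' s _; rewrite // (lt_le_trans ax xs) (le_lt_trans sy yb).
- by rewrite mul0r.
Qed.

End MatrixNorm.

(** * The matrix exponential and linear differential equations *)

Section MatrixExponential.
Variable R : realType.

(* With coefficients [X M^k Y], differentiating the power series amounts to
   replacing [X] by [X *m M]. *)
Definition expmx_coef (p q r : nat) (X : 'M[R]_(p, q)) (M : 'M[R]_q)
    (Y : 'M[R]_(q, r)) (i : 'I_p) (j : 'I_r) (k : nat) : R :=
  k`!%:R^-1 * (X *m M ^+ k *m Y) i j.

(* [exprZn] does not apply: 'M_q is declared an algebra only for [q = q'.+1]. *)
Lemma exprZ_mx (q : nat) (M : 'M[R]_q) (a : R) k : (a *: M) ^+ k = a ^+ k *: M ^+ k.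
Proof.
elim: k => [|k IH]; first by rewrite !expr0 scale1r.
rewrite !exprS IH -[LHS]/((a *: M) *m (a ^+ k *: M ^+ k)).
by rewrite -scalemxAl -scalemxAr scalerA.
Qed.

(** The factor [|1%:M|] comes from [k = 0]; keeping it symbolic spares a separate case for
    [q = 0]. *)
Lemma mx_norm_exprn (q : nat) (M : 'M[R]_q) k :
  `|M ^+ k| <= `|1%:M : 'M[R]_q| * (q%:R * `|M|) ^+ k.
Proof.
elim: k => [|k IH]; first by rewrite !expr0 mulr1.
rewrite exprS; apply: le_trans (mx_norm_mulmx _ _) _.
by rewrite exprS mulrA [leRHS]mulrCA ler_wpM2l ?mulr_ge0.
Qed.

(** Absolute convergence by comparison with the real exponential series at [q%:R * |M| * |x|]; [C]
    collects the factors of the two outer products and of the power bound. *)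
Lemma is_cvg_pseries_expmx_coef (p q r : nat) (X : 'M[R]_(p, q)) (M : 'M[R]_q)
    (Y : 'M[R]_(q, r)) i j (x : R) :
  cvgn (pseries (expmx_coef X M Y i j) x).
Proof.
pose C : R := q%:R * (q%:R * (`|X| * `|1%:M : 'M[R]_q|) * `|Y|).
apply: normed_cvg.
apply: (@series_le_cvg _ _ (C *: exp_coeff (q%:R * `|M| * `|x|))) => [//=|k|k|].
- by rewrite mulr_ge0 ?exp_coeff_ge0 ?mulr_ge0.
- rewrite /= normrM normrX /expmx_coef normrM ger0_norm ?invr_ge0 //.
  have -> : (C *: exp_coeff (q%:R * `|M| * `|x|)) k =
      k`!%:R^-1 * (C * (q%:R * `|M|) ^+ k) * `|x| ^+ k.
    rewrite -[LHS]/(C * ((q%:R * `|M| * `|x|) ^+ k / k`!%:R)).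
    by rewrite [(_ * `|x|) ^+ k]exprMn; ring.
  rewrite ler_wpM2r ?ler_wpM2l ?exprn_ge0 ?invr_ge0 //.
  apply: le_trans (ler_mx_entry _ _ _) _.
  apply: le_trans (mx_norm_mulmx _ _) _.
  rewrite /C -[leRHS]mulrA ler_wpM2l // mulrAC ler_wpM2r //.
  apply: le_trans (mx_norm_mulmx _ _) _.
  by rewrite -!mulrA ler_wpM2l // ler_wpM2l // mx_norm_exprn.
- exact/is_cvg_seriesZ/is_cvg_series_exp_coeff.
Qed.

Lemma pseries_expmx_coef (p q r : nat) (X : 'M[R]_(p, q)) (M : 'M[R]_q)
    (Y : 'M[R]_(q, r)) i j (x : R) n :
  pseries (expmx_coef X M Y i j) x n =
  (X *m series (fun k : nat => k`!%:R^-1 *: (x *: M) ^+ k) n *m Y) i j.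
Proof.
rewrite /pseries /series /= mulmx_sumr mulmx_suml summxE; apply: eq_bigr => k _.
rewrite /= exprZ_mx -!(scalemxAr, scalemxAl) !mxE /expmx_coef.
by rewrite mxE mulrAC -mulrA.
Qed.

Lemma cvg_expmx (q : nat) (M : 'M[R]_q) :
  series (fun k : nat => k`!%:R^-1 *: M ^+ k) @ \oo --> expmx M.
Proof.
suff : cvgn (series (fun k : nat => k`!%:R^-1 *: M ^+ k)) by [].
apply/cvg_ex; exists (\matrix_(i, j) limn (pseries (expmx_coef 1%:M M 1%:M i j) 1)).
apply/cvg_mxP => i j; rewrite mxE.
set f := (fun n => _ i j).
have -> : f = pseries (expmx_coef 1%:M M 1%:M i j) 1.
  by apply/funext => n; rewrite pseries_expmx_coef mul1mx mulmx1 scale1r.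
exact: is_cvg_pseries_expmx_coef.
Qed.

(** Turns entries of exponentials into sums of real power series in [x], so that identities between
    exponentials reduce to identities between coefficients. *)
Lemma cvg_pseries_expmx_coef (p q r : nat) (X : 'M[R]_(p, q)) (M : 'M[R]_q)
    (Y : 'M[R]_(q, r)) i j (x : R) :
  pseries (expmx_coef X M Y i j) x @ \oo --> (X *m expmx (x *: M) *m Y) i j.
Proof.
pose S n := X *m series (fun k : nat => k`!%:R^-1 *: (x *: M) ^+ k) n *m Y.
have /cvg_mxP/(_ i j) : S @ \oo --> X *m expmx (x *: M) *m Y.
  apply: cvg_mulmx; last exact: cvg_cst.
  by apply: cvg_mulmx; [exact: cvg_cst | exact: cvg_expmx].
suff -> : pseries (expmx_coef X M Y i j) x = (fun n => S n i j) by [].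
by apply/funext => n; rewrite pseries_expmx_coef.
Qed.

Lemma expmxC (q : nat) (M : 'M[R]_q) (x : R) :
  M *m expmx (x *: M) = expmx (x *: M) *m M.
Proof.
apply/matrixP => i j.
have := @cvg_pseries_expmx_coef _ _ _ M M 1%:M i j x.
have := @cvg_pseries_expmx_coef _ _ _ 1%:M M M i j x.
(* Both coefficients come from the same power [M ^+ k.+1]. *)
have -> : expmx_coef M M 1%:M i j = expmx_coef 1%:M M M i j.
  apply/funext => k; rewrite /expmx_coef mulmx1 mul1mx.
  by rewrite -[M *m _]/(M * M ^+ k) -exprS exprSr.
by rewrite mulmx1 mul1mx => /cvg_lim <- // /cvg_lim <-.
Qed.

Lemma expmx_tr (q : nat) (M : 'M[R]_q) : expmx M^T = (expmx M)^T.
Proof.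
apply/matrixP => i j; rewrite mxE.
have := @cvg_pseries_expmx_coef _ _ _ 1%:M M^T 1%:M i j 1.
have := @cvg_pseries_expmx_coef _ _ _ 1%:M M 1%:M j i 1.
have -> : expmx_coef 1%:M M^T 1%:M i j = expmx_coef 1%:M M 1%:M j i.
  apply/funext => k; rewrite /expmx_coef !mulmx1 !mul1mx; congr (_ * _).
  suff -> : M^T ^+ k = (M ^+ k)^T by rewrite mxE.
  elim: k => [|k IH]; first by rewrite !expr0 [RHS]trmx1.
  by rewrite exprS exprSr [RHS]trmx_mul -IH.
by rewrite !mulmx1 !mul1mx !scale1r => /cvg_lim <- // /cvg_lim <-.
Qed.

Lemma expmx0 (q : nat) : expmx (0 : 'M[R]_q) = 1%:M.
Proof.
(* The shift skips the empty partial sum; every other one reduces to its term [k = 0]. *)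
apply/cvg_lim => //; rewrite -cvg_shiftS.
apply: cvg_near_cst; near=> n.
rewrite /series /= big_nat_recl //= fact0 invr1 scale1r expr0 big1 ?addr0 // => k _.
by rewrite expr0n scaler0.
Unshelve. all: by end_near. Qed.

(** Termwise differentiation of the power series of each entry, inside the radius [|x| + 1]; by [dE]
    each differentiation inserts one more factor [M]. *)
Lemma is_derive_expmx (q : nat) (M : 'M[R]_q) (x : R) :
  is_derive x (1 : R) (fun s => expmx (s *: M)) (M *m expmx (x *: M)).
Proof.
apply/is_derive_mxP => i j.
have dE (X : 'M[R]_q) : pseries_diffs (expmx_coef X M 1%:M i j) =
    expmx_coef (X *m M) M 1%:M i j.
  apply/funext => k; rewrite /pseries_diffs /expmx_coef factS natrM invfM.
  rewrite mulrA mulVKf // exprS.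
  by rewrite -[M * _]/(M *m M ^+ k) mulmxA.
have := @pseries_snd_diffs R (expmx_coef 1%:M M 1%:M i j) (`|x| + 1) x.
rewrite !dE => /(_ _ _ _ _)/= H.
have -> : (fun s => expmx (s *: M) i j) =
    (fun s => limn (pseries (expmx_coef 1%:M M 1%:M i j) s)).
  apply/funext => s; apply/esym/cvg_lim => //.
  by have := @cvg_pseries_expmx_coef _ _ _ 1%:M M 1%:M i j s; rewrite mul1mx mulmx1.
apply: is_derive_eq.
  by apply: H; try exact: is_cvg_pseries_expmx_coef; rewrite [ltRHS]ger0_norm ?ltrDl // addr_ge0.
apply/cvg_lim => //.
by have := @cvg_pseries_expmx_coef _ _ _ (1%:M *m M) M 1%:M i j x; rewrite mul1mx mulmx1.
Qed.

Lemma is_derive_expmx_rev (q : nat) (M : 'M[R]_q) (a x : R) :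
  is_derive x (1 : R) (fun s => expmx ((a - s) *: M)) (- (M *m expmx ((a - x) *: M))).
Proof.
apply/is_derive_mxP => i j.
have /is_derive_mxP/(_ i j) H := is_derive_expmx M (a - x).
have Hg : is_derive x (1 : R) (fun s => a - s) (- 1).
  by apply: (is_derive_eq (is_deriveB (is_derive_cst a x 1) (is_derive_id x 1))); rewrite sub0r.
have := @is_derive1_comp R _ (fun s => a - s) x _ _ H Hg.
by rewrite mulrN1 [X in _ -> is_derive _ _ _ X]mxE.
Qed.

Lemma expmxN (q : nat) (M : 'M[R]_q) (x : R) :
  expmx (x *: M) *m expmx (- x *: M) = 1%:M.
Proof.
(* This product has zero derivative. Writing [0 - s] matches the reversed-time derivative. *)
pose f (s : R) := expmx (s *: M) *m expmx ((0 - s) *: M).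
have <- : f 0 = 1%:M by rewrite /f subr0 !scale0r expmx0 mulmx1.
have -> : expmx (x *: M) *m expmx (- x *: M) = f x by rewrite /f sub0r.
(* Any open interval containing both [0] and [x] would do. *)
apply: (@derive0_mx_cst _ _ _ f (- `|x| - 1) (`|x| + 1)).
- move=> s _.
  apply: (is_derive_eq (is_derive_mulmx (is_derive_expmx M s) (is_derive_expmx_rev M 0 s))).
  by rewrite mulmxN expmxC -mulmxA subrr.
- have := ler_norm x; have := ler_norm (- x); rewrite normrN; lra.
- have := normr_ge0 x; lra.
Qed.

Lemma continuous_expmx (q : nat) (M : 'M[R]_q) :
  continuous (fun s : R => expmx (s *: M)).
Proof.
move=> x; have [dM _] := is_derive_expmx M x.
exact/differentiable_continuous/derivable1_diffP.
Qed.

(** Undoing the flow gives [z r = expmx ((a - r) *: M) *m y r], whose derivative vanishes on the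
    open interval. The right limit at [a] identifies the constant and left continuity at [b] extends
    it to [b]. The value [y a] is left free, since at an impulse it differs from the right limit
    [y0]. *)
Lemma linear_ode_solution (q : nat) (M : 'M[R]_q) (y : R -> 'cV[R]_q) (y0 : 'cV[R]_q)
    (a b : R) :
  (forall s, a < s < b -> is_derive s (1 : R) y (M *m y s)) ->
  y s @[s --> a^'+] --> y0 -> y s @[s --> b^'-] --> y b ->
  forall s, a < s <= b -> y s = expmx ((s - a) *: M) *m y0.
Proof.
move=> yd ya yb s /andP[as_ sb].
pose z r := expmx ((a - r) *: M) *m y r.
have zd r : a < r < b -> is_derive r (1 : R) z 0.
  move=> /yd ydr.
  apply: (is_derive_eq (is_derive_mulmx (is_derive_expmx_rev M a r) ydr)).
  by rewrite mulNmx mulmxA expmxC addNr.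
have ab : a < b := lt_le_trans as_ sb.
have expc : continuous (fun r : R => expmx ((a - r) *: M)).
  move=> c; have [dM _] := is_derive_expmx_rev M a c.
  exact/differentiable_continuous/derivable1_diffP.
have za : z r @[r --> a^'+] --> y0.
  rewrite -[y0]mul1mx -expmx0 -(scale0r M) -(subrr a).
  by apply: cvg_mulmx => //; apply: cvg_at_right_filter; exact: expc.
have zb : z r @[r --> b^'-] --> z b.
  by apply: cvg_mulmx => //; apply: cvg_at_left_filter; exact: expc.
pose c := z ((a + b) / 2).
have zc r : a < r < b -> z r = c.
  by move=> arb; apply: (derive0_mx_cst zd) => //; have := ab; lra.
have cy0 : c = y0.
  rewrite -(cvg_lim _ za) //; apply/esym/cvg_lim => //; apply: cvg_near_cst; near=> r; apply: zc.
  by apply/andP; split; near: r; [exact: nbhs_right_gt | exact: nbhs_right_lt].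
have zs : z s = y0.
  move: sb; rewrite le_eqVlt => /predU1P[->|sb]; last by rewrite zc ?cy0 // as_ sb.
  rewrite -cy0 -(cvg_lim _ zb) //; apply/cvg_lim => //; apply: cvg_near_cst; near=> r; apply: zc.
  by apply/andP; split; near: r; [exact: nbhs_left_gt | exact: nbhs_left_lt].
by rewrite -zs /z mulmxA -[a - s]opprB expmxN mul1mx.
Unshelve. all: by end_near. Qed.

End MatrixExponential.

(** * Quadratic forms: uniform positivity and contraction *)

Section QuadraticForms.
Variable R : realType.

Lemma quad_form_congr (q : nat) (X M : 'M[R]_q) (v : 'cV[R]_q) :
  quad_form (X^T *m M *m X) v = quad_form M (X *m v).
Proof. by rewrite /quad_form trmx_mul !mulmxA. Qed.

Lemma quad_formB (q : nat) (M L : 'M[R]_q) (v : 'cV[R]_q) :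
  quad_form (M - L) v = quad_form M v - quad_form L v.
Proof. by rewrite /quad_form mulmxBr mulmxBl !mxE. Qed.

Lemma quad_form_sum (q : nat) (I : finType) (c : I -> R) (M : I -> 'M[R]_q)
    (v : 'cV[R]_q) :
  quad_form (\sum_i c i *: M i) v = \sum_i c i * quad_form (M i) v.
Proof.
rewrite /quad_form mulmx_sumr mulmx_suml summxE; apply: eq_bigr => i _.
by rewrite -scalemxAr -scalemxAl mxE.
Qed.

Lemma quad_formZv (q : nat) (M : 'M[R]_q) (a : R) (v : 'cV[R]_q) :
  quad_form M (a *: v) = a ^+ 2 * quad_form M v.
Proof.
have vT : (a *: v)^T = a *: v^T by apply/matrixP => i j; rewrite !mxE.
by rewrite /quad_form vT -scalemxAr -!scalemxAl scalerA mxE expr2.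
Qed.

Lemma quad_formv0 (q : nat) (M : 'M[R]_q) : quad_form M 0 = 0.
Proof. by rewrite /quad_form mulmx0 mxE. Qed.

Lemma posdefmx_ge0 (q : nat) (M : 'M[R]_q) v : posdefmx M -> 0 <= quad_form M v.
Proof.
case=> _ Mpos; have [->|/Mpos/ltW//] := eqVneq v 0; by rewrite quad_formv0.
Qed.

Lemma quad_form_le_norm (q : nat) (M : 'M[R]_q) (v : 'cV[R]_q) :
  quad_form M v <= q%:R ^+ 2 * `|M| * `|v| ^+ 2.
Proof.
apply: le_trans (ler_norm _) _; apply: le_trans (ler_mx_entry _ _ _) _.
apply: le_trans (mx_norm_mulmx _ _) _.
have -> : q%:R ^+ 2 * `|M| * `|v| ^+ 2 = q%:R * (q%:R * (`|v^T| * `|M|) * `|v|).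
  by rewrite mx_norm_tr; ring.
by rewrite ler_wpM2l // ler_wpM2r // mx_norm_mulmx.
Qed.

(** A positive continuous function attains a positive minimum on the compact product of the segment
    and the unit sphere; homogeneity of degree two extends the bound to all vectors. *)
Lemma quad_form_family_ge (q : nat) (F : R -> 'M[R]_q) (a b : R) :
  a <= b -> continuous F ->
  (forall s (v : 'cV[R]_q), a <= s <= b -> v != 0 -> 0 < quad_form (F s) v) ->
  exists2 mu : R, 0 < mu &
    forall s v, a <= s <= b -> mu * `|v| ^+ 2 <= quad_form (F s) v.
Proof.
move=> ab Fc Fpos.
have Fscale s (v : 'cV[R]_q) : v != 0 ->
    quad_form (F s) v = `|v| ^+ 2 * quad_form (F s) (`|v|^-1 *: v)
    /\ `|(`|v|^-1 *: v)^T| = 1.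
  rewrite -normr_eq0 => v0; rewrite quad_formZv mulrA -exprMn divff // expr1n mul1r.
  by rewrite mx_norm_tr normrZ normfV normr_id mulVf.
(* An empty sphere leaves only the zero vector, and then any [mu] works. The sphere consists of row
   vectors to fit [bounded_closed_compact]. *)
have [[w0 w01]|sphere0] := pselect (exists w : 'rV[R]_q, `|w| = 1); last first.
  exists 1 => // s v _; have [->|v0] := eqVneq v 0.
    by rewrite quad_formv0 normr0 expr0n mulr0.
  by case: sphere0; exists (`|v|^-1 *: v)^T; have [] := Fscale a v v0.
pose K := `[a, b]%classic `*` [set w : 'rV[R]_q | `|w| = 1].
pose g (p : R * 'rV[R]_q) : R := quad_form (F p.1) p.2^T.
have Kc : compact K.
  apply: compact_setX; first exact: segment_compact.
  apply: bounded_closed_compact.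
    exists 1; split; first exact: num_real.
    by move=> y y1 w /= ->; exact: ltW.
  apply: (@closed_comp _ _ (fun w : 'rV[R]_q => `|w|) [set x | x = 1]).
    by move=> w _; exact: norm_continuous.
  exact: closed_eq.
have gc : continuous g.
  move=> p; rewrite /g /quad_form; under eq_fun do rewrite trmxK.
  have c1 : (fun p : R * 'rV[R]_q => F p.1) @ p --> F p.1.
    by apply: (cvg_comp fst F); [exact: cvg_fst | exact: Fc].
  have c2 : (fun p : R * 'rV[R]_q => p.2) @ p --> p.2 by exact: cvg_snd.
  have c3 : (fun p : R * 'rV[R]_q => p.2^T) @ p --> p.2^T.
    apply/cvg_mxP => i j; under eq_fun do rewrite mxE.
    by rewrite mxE; move/cvg_mxP : c2; exact.
  have /cvg_mxP/(_ ord0 ord0) : (fun p : R * 'rV[R]_q => p.2 *m F p.1 *m p.2^T) @ p -->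
      p.2 *m F p.1 *m p.2^T.
    by apply: cvg_mulmx => //; exact: cvg_mulmx.
  by rewrite /continuous_at.
have K0 : K !=set0.
  by exists (a, w0); split => //=; rewrite in_itv /= lexx.
have [[c w] /[!inE] -[/= cab w1] gmin] :=
  compact_EVT_min K0 Kc (continuous_subspaceT gc).
exists (g (c, w)).
  apply: Fpos; first by rewrite in_itv in cab.
  by apply/eqP => w0'; move: w1; rewrite -mx_norm_tr w0' normr0 => /esym/eqP; rewrite oner_eq0.
move=> s v sab; have [->|v0] := eqVneq v 0.
  by rewrite quad_formv0 normr0 expr0n mulr0.
have [-> n1] := Fscale s v v0.
rewrite mulrC ler_wpM2l ?exprn_ge0 //.
have := gmin (s, (`|v|^-1 *: v)^T); rewrite /g /= trmxK; apply.
by rewrite inE; split => //=; rewrite in_itv.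
Qed.

Lemma posdefmx_ge (q : nat) (M : 'M[R]_q) : posdefmx M ->
  exists2 mu : R, 0 < mu & forall v, mu * `|v| ^+ 2 <= quad_form M v.
Proof.
move=> [_ Mpos].
have [|s v _|mu mu0 H] := @quad_form_family_ge q (fun=> M) 0 0 (lexx _).
- exact: cst_continuous.
- exact: Mpos.
- by exists mu => // v; apply: (H 0); rewrite lexx.
Qed.

(** Uniform positivity of [P - F s] gives a gap [mu * |v| ^+ 2], and [|v| ^+ 2] is at least the form
    of [P] divided by [C]: a fixed fraction [mu / C] of that form is lost. *)
Lemma negdefmx_family_contraction (q : nat) (F : R -> 'M[R]_q) (P : 'M[R]_q)
    (a b : R) :
  a <= b -> continuous F -> posdefmx P ->
  (forall s, a <= s <= b -> negdefmx (F s - P)) ->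
  exists rho : R, 0 <= rho < 1 /\
    forall s v, a <= s <= b -> quad_form (F s) v <= rho * quad_form P v.
Proof.
move=> ab Fc Ppos Fneg.
have [||mu mu0 H] := @quad_form_family_ge q (fun s => P - F s) a b ab.
- by move=> s; apply: cvgB; [exact: cvg_cst | exact: Fc].
- by move=> s v /Fneg[_ sab] /sab; rewrite !quad_formB; lra.
(* Adding [mu] to the norm bound ensures both [0 < C] and [mu <= C], hence a rate that is
   nonnegative. *)
pose C : R := q%:R ^+ 2 * `|P| + mu.
have C0 : 0 < C by rewrite ltr_wpDl // mulr_ge0 ?exprn_ge0.
exists (1 - mu / C); split.
  rewrite subr_ge0 ler_pdivrMr // mul1r lerDr ?mulr_ge0 ?exprn_ge0 //=.
  by rewrite ltrBlDr ltrDl divr_gt0.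
move=> s v sab; have := H s v sab; rewrite quad_formB => Hs.
suff : mu / C * quad_form P v <= mu * `|v| ^+ 2 by lra.
rewrite -mulrA ler_pM2l // mulrC ler_pdivrMr //.
apply: le_trans (quad_form_le_norm _ _) _.
by rewrite mulrC ler_wpM2l ?exprn_ge0 // lerDl ltW.
Qed.

End QuadraticForms.

(** * Trajectories of the switched system: impulse instants, flow and jumps *)

Section Trajectories.
Variables (R : realType) (n m N : nat).
Variables (A : 'I_N -> 'M[R]_n) (B : 'I_N -> 'M[R]_(n, m)).
Variables (J : 'I_N -> 'I_N -> 'M[R]_n).
Variables (K1 : 'I_N -> 'I_N -> 'M[R]_(m, n)) (K2 : 'I_N -> 'I_N -> 'M[R]_m).
Variable P : 'I_N -> 'M[R]_(n + m).
Variables (Tmin Tmax : R).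
Hypothesis Tmin_gt0 : 0 < Tmin.
Variable t : nat -> R.
Hypothesis t0_ge0 : 0 <= t 0%N.
Hypothesis dwell_time : forall k : nat, Tmin <= t k.+1 - t k <= Tmax.

Let t_lt k : t k < t k.+1.
Proof. by have := dwell_time k; have := Tmin_gt0; lra. Qed.

Let t_mono : {mono t : i j / (i <= j)%N >-> i <= j}.
Proof. by apply/increasing_seqP. Qed.

(** The lower dwell-time bound makes [t] grow at least linearly, which excludes accumulation of
    impulses; the least index [k] with [s <= t k] is then a successor. *)
Lemma impulse_interval s : t 0%N < s -> exists k, t k < s <= t k.+1.
Proof.
move=> t0s.
have tge k : t 0%N + k%:R * Tmin <= t k.
  elim: k => [|k IH]; first by rewrite mul0r addr0.
  by rewrite -natr1; have := dwell_time k; lra.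
have ex : exists k, s <= t k.
  have s0 : 0 <= s / Tmin by rewrite divr_ge0 ?ltW // (le_lt_trans _ t0s).
  exists (Num.bound (s / Tmin)); apply: le_trans (tge _).
  have := archi_boundP s0; rewrite ltr_pdivrMr // => /ltW ?.
  by have := t0_ge0; lra.
case: (ex_minnP ex) => -[|k] sk kmin; first by move: t0s; rewrite ltNge sk.
exists k; rewrite sk andbT ltNge; apply/negP => /kmin.
by rewrite ltnn.
Qed.

(** The held input [w] has zero derivative, which is what the zero lower blocks express, so the
    stacked state solves a linear equation. *)
Lemma sampled_flow (A0 : 'M[R]_n) (B0 : 'M[R]_(n, m)) (x : R -> 'cV[R]_n)
    (w : 'cV[R]_m) (x0 : 'cV[R]_n) (a b : R) :
  (forall s, a < s < b -> is_derive s (1 : R) x (A0 *m x s + B0 *m w)) ->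
  x s @[s --> a^'+] --> x0 -> x s @[s --> b^'-] --> x b ->
  forall s, a < s <= b ->
    col_mx (x s) w = expmx ((s - a) *: block_mx A0 B0 0 0) *m col_mx x0 w.
Proof.
move=> xd xa xb s sab.
have cvg_col (F : set_system R) (l : 'cV[R]_n) : Filter F -> x @ F --> l ->
    (fun r => col_mx (x r) w) @ F --> col_mx l w.
  move=> FF /cvg_mxP xl; apply/cvg_mxP => i j.
  have [k ->|k ->] := split_ordP i.
    by under eq_fun do rewrite col_mxEu; rewrite col_mxEu; exact: xl.
  by under eq_fun do rewrite col_mxEd; rewrite col_mxEd; exact: cvg_cst.
apply: (@linear_ode_solution _ _ _ (fun r => col_mx (x r) w) _ a b) => //.
- move=> r /xd /is_derive_mxP xdr; apply/is_derive_mxP => i j.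
  rewrite mul_block_col !mul0mx addr0.
  have [k ->|k ->] := split_ordP i.
    by under eq_fun do rewrite col_mxEu; rewrite col_mxEu; exact: xdr.
  under eq_fun do rewrite col_mxEd; rewrite col_mxEd mxE; exact: is_derive_cst.
- exact: cvg_col.
- exact: cvg_col.
Qed.

Section OneTrajectory.
Variables (x : R -> 'cV[R]_n) (u : R -> 'cV[R]_m) (sigma : R -> 'I_N).
Hypothesis traj : min_jumping_trajectory A B J K1 K2 P t x u sigma.

Lemma traj_before_impulses s : 0 <= s <= t 0%N ->
  aug x u s = expmx (s *: Abar A B (sigma 0)) *m aug x u 0.
Proof.
(* The point [s = 0] is treated apart, as [sampled_flow] covers only the half-open interval beyond
   its left end. *)
case/andP=> s0 st; have [->|s_neq0] := eqVneq s 0.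
  by rewrite scale0r expmx0 mul1mx.
have sgt0 : 0 < s by rewrite lt_def s_neq0.
have t0gt0 : 0 < t 0%N := lt_le_trans sgt0 st.
have us r : 0 <= r <= t 0%N -> u r = u 0 by move=> /(traj_init traj)[].
rewrite /aug us ?s0 // -[s in expmx (s *: _)]subr0.
apply: (@sampled_flow _ _ _ _ _ 0 (t 0%N)); last by rewrite sgt0.
- move=> r /andP[r0 rt]; have r0t : 0 <= r <= t 0%N by rewrite !ltW.
  have [<- <-] := traj_init traj r0t; apply: (traj_flow traj) => // k.
  by apply/eqP; rewrite lt_eqF // (lt_le_trans rt) // t_mono.
- (* the one-sided derivative at 0 gives continuity there: x h = h * (dx/h) + x 0 *)
  have := traj_flow0 traj t0gt0; set L := (A _ *m _ + _) => dx.
  have : (fun h : R => h *: (h^-1 *: (x h - x 0)) + x 0) @ 0^'+ --> (0 : R) *: L + x 0.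
    apply: cvgD; last exact: cvg_cst.
    apply: cvgZ => //; apply: cvg_at_right_filter; exact: cvg_id.
  rewrite scale0r add0r; apply: cvg_trans; apply: near_eq_cvg.
  near=> h; have h0 : 0 < h by near: h; exact: nbhs_right_gt.
  by rewrite scalerA mulfV ?gt_eqF // scale1r subrK.
- exact: (traj_left_continuous traj).
Unshelve. all: by end_near. Qed.

(** The mode selected at [t k] is held up to and including [t k.+1], so [sigma (t k.+1)] names it
    without a choice of witness. *)
Lemma traj_between_impulses k s : t k < s <= t k.+1 ->
  aug x u s = expmx ((s - t k) *: Abar A B (sigma (t k.+1))) *m
    (Jbar J K1 K2 (sigma (t k.+1)) (sigma (t k)) *m aug x u (t k)).
Proof.
move=> ks; have [j [sj us xj _]] := traj_jump traj k.
have -> : sigma (t k.+1) = j by apply: sj; rewrite t_lt lexx.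
rewrite /aug us // /Jbar mul_block_col mul0mx addr0.
apply: (@sampled_flow _ _ _ _ _ (t k) (t k.+1)) => //.
- move=> r /andP[kr rk]; have kr' : t k < r <= t k.+1 by rewrite kr ltW.
  rewrite -(us r) // -(sj r) //; apply: (traj_flow traj).
    by apply: le_lt_trans kr; apply: le_trans t0_ge0 _; rewrite t_mono.
  move=> l; apply/eqP; case: (leqP l k) => lk.
    by rewrite gt_eqF // (le_lt_trans _ kr) // t_mono.
  by rewrite lt_eqF // (lt_le_trans rk) // t_mono.
- apply: (traj_left_continuous traj).
  by apply: le_lt_trans (t_lt k); apply: le_trans t0_ge0 _; rewrite t_mono.
Qed.

Lemma traj_min_jump k l :
  let post j := Jbar J K1 K2 j (sigma (t k)) *m aug x u (t k) in
  quad_form (P (sigma (t k.+1))) (post (sigma (t k.+1))) <= quad_form (P l) (post l).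
Proof.
have [j [sj _ _ jmin]] := traj_jump traj k.
have -> : sigma (t k.+1) = j by apply: sj; rewrite t_lt lexx.
by have := jmin l; rewrite !quad_form_congr.
Qed.

End OneTrajectory.

End Trajectories.

(** * Uniform constants over finite families, and stability from geometric decay *)

Lemma fin_ub (R : realType) (I : finType) (f : I -> R) :
  exists2 C : R, 0 < C & forall i, f i <= C.
Proof.
exists (1 + \sum_i `|f i|) => [|i]; first by rewrite ltr_pwDl // sumr_ge0.
apply: le_trans (ler_norm _) _; rewrite (bigD1 i) //= addrCA lerDl.
by rewrite addr_ge0 // sumr_ge0.
Qed.

Lemma fin_pos_lb (R : realType) (I : finType) (f : I -> R) :
  (forall i, 0 < f i) -> exists2 c : R, 0 < c & forall i, c <= f i.
Proof.
(* An upper bound on the inverses is inverted into a positive lower bound. *)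
move=> f0; have [C C0 fC] := fin_ub (fun i => (f i)^-1).
by exists C^-1 => [|i]; rewrite ?invr_gt0 // -[f i]invrK lef_pV2 ?posrE ?invr_gt0.
Qed.

Lemma expmx_family_bounded (R : realType) (I : finType) (q : nat)
    (M : I -> 'M[R]_q) (T : R) : 0 <= T ->
  exists2 C : R, 0 < C & forall i s, 0 <= s <= T -> `|expmx (s *: M i)| <= C.
Proof.
move=> T0.
have /fin_all_exists[c Hc] i : exists c, forall s, 0 <= s <= T -> `|expmx (s *: M i)| <= c.
  have cE : {within `[0, T], continuous (fun s : R => `|expmx (s *: M i)|)}.
    apply: continuous_subspaceT => s.
    apply: (cvg_comp (fun s : R => expmx (s *: M i)) (fun L : 'M[R]_q => `|L|)).
      exact: continuous_expmx.
    exact: norm_continuous.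
  have [c _ cmax] := EVT_max T0 cE.
  by exists `|expmx (c *: M i)| => s sT; apply: cmax; rewrite in_itv.
have [C C0 cC] := fin_ub c.
by exists C => // i s sT; apply: le_trans (Hc i s sT) (cC i).
Qed.

(** Norms appear squared because the bounds come from quadratic forms. Stability uses only the
    constant [D]; convergence uses the decay in [k]. *)
Lemma geometric_decay_stable (R : realType) (q : nat) (S : set (R -> 'cV[R]_q))
    (t : nat -> R) (D rho : R) :
  (forall s, t 0%N < s -> exists k, t k < s <= t k.+1) ->
  {homo t : i j / (i <= j)%N >-> i <= j} ->
  0 <= D -> 0 <= rho < 1 ->
  (forall chi s, S chi -> 0 <= s <= t 0%N -> `|chi s| ^+ 2 <= D * `|chi 0| ^+ 2) ->
  (forall chi k s, S chi -> t k < s <= t k.+1 ->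
     `|chi s| ^+ 2 <= D * rho ^+ k * `|chi 0| ^+ 2) ->
  asymptotically_stable S.
Proof.
move=> tcover tmono D0 /andP[rho0 rho1] Sinit Sdecay; split.
  move=> eps eps0; have D1 : 0 < D + 1 by rewrite ltr_wpDl.
  (* This avoids a square root: [D * c ^+ 2 <= (c * (D + 1)) ^+ 2]. *)
  exists (eps / (D + 1)) => [|chi Schi chi0 s s0]; first exact: divr_gt0.
  have bound : `|chi s| ^+ 2 <= D * `|chi 0| ^+ 2.
    have [st|/tcover[k ks]] := leP s (t 0%N); first by apply: Sinit; rewrite ?s0.
    apply: le_trans (Sdecay _ _ _ Schi ks) _; rewrite ler_wpM2r ?exprn_ge0 //.
    by rewrite ler_piMr // exprn_ile1 // ltW.
  rewrite -(@ltr_pXn2r _ 2%N) ?nnegrE ?(ltW eps0) //.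
  apply: le_lt_trans bound _.
  have : `|chi 0| * (D + 1) < eps by rewrite -ltr_pdivlMr.
  have := normr_ge0 (chi 0); set c := `|_| => c0 ceps.
  apply: (@le_lt_trans _ _ ((c * (D + 1)) ^+ 2)); first by rewrite exprMn; nra.
  by rewrite ltr_pXn2r ?nnegrE ?mulr_ge0 // ltW.
move=> chi Schi; apply/cvgr0Pnorm_lt => eps eps0.
have cvg_geo : D * rho ^+ k * `|chi 0| ^+ 2 @[k --> \oo] --> (0 : R).
  set c := `|chi 0| ^+ 2; rewrite -(mul0r c) -(mulr0 D).
  apply: cvgM; last exact: cvg_cst.
  by apply: cvgM; [exact: cvg_cst | apply: cvg_expr; rewrite ger0_norm].
have [k0 _ kbound] : \forall k \near \oo, D * rho ^+ k * `|chi 0| ^+ 2 < eps ^+ 2.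
  by apply: (cvgr_lt _ cvg_geo); rewrite exprn_gt0.
exists (t k0); split; first exact: num_real.
move=> s ks; rewrite -(@ltr_pXn2r _ 2%N) ?nnegrE ?(ltW eps0) //.
have [k /andP[ks' sk]] := tcover s (le_lt_trans (tmono 0%N k0 (leq0n _)) ks).
apply: le_lt_trans (Sdecay _ k _ Schi _) _; first by rewrite ks'.
(* If [k < k0], then [s <= t k.+1 <= t k0], contrary to the choice of [s]. *)
apply: kbound => /=; rewrite -ltnS ltnNge; apply/negP => kk0.
by have := tmono _ _ kk0; rewrite leNgt (lt_le_trans ks).
Qed.

(** * Common constants for all modes and decrease of the Lyapunov function *)

Theorem proposition11 (R : realType) (n m N : nat)
  (n_gt0 : (0 < n)%N) (m_gt0 : (0 < m)%N) (N_gt0 : (0 < N)%N)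
  (A : 'I_N -> 'M[R]_n) (B : 'I_N -> 'M[R]_(n, m))
  (J : 'I_N -> 'I_N -> 'M[R]_n)
  (K1 : 'I_N -> 'I_N -> 'M[R]_(m, n)) (K2 : 'I_N -> 'I_N -> 'M[R]_m)
  (Tmin Tmax : R) (Tmin_gt0 : 0 < Tmin) (Tmin_le_Tmax : Tmin <= Tmax)
  (P : 'I_N -> 'M[R]_(n + m)) (Pi : 'M[R]_N)
  (P_posdef : forall i : 'I_N, posdefmx (P i))
  (Pi_ge0 : forall i j : 'I_N, 0 <= Pi i j)
  (Pi_colsum : (const_mx 1 : 'cV[R]_N)^T *m Pi = (const_mx 1 : 'cV[R]_N)^T)
  (LMI : forall (i : 'I_N) (theta : R), Tmin <= theta <= Tmax ->
     negdefmx
       (expmx (theta *: (Abar A B i)^T)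
        *m (\sum_(j < N) Pi j i *: ((Jbar J K1 K2 j i)^T *m P j *m Jbar J K1 K2 j i))
        *m expmx (theta *: Abar A B i)
        - P i))
  (t : nat -> R) (t0_ge0 : 0 <= t 0%N)
  (dwell_time : forall k : nat, Tmin <= t k.+1 - t k <= Tmax) :
  asymptotically_stable (min_jumping_solutions A B J K1 K2 P t).
Proof.
pose E i s := expmx (s *: Abar A B i).
have colsum i : \sum_(j < N) Pi j i = 1.
  move/matrixP/(_ ord0 i): Pi_colsum; rewrite !mxE => <-.
  by apply: eq_bigr => j _; rewrite !mxE mul1r.
have ETr i s : expmx (s *: (Abar A B i)^T) = (E i s)^T.
  by rewrite -expmx_tr; congr expmx; apply/matrixP => a b; rewrite !mxE.
(* With [v] a post-impulse state, [E i s *m v] is the state at the next impulse, and the left side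
   averages the candidate values of the jumping rule there. *)
have /fin_all_exists[r Hr] i : exists r : R, 0 <= r < 1 /\ forall s v,
    Tmin <= s <= Tmax ->
    \sum_(j < N) Pi j i * quad_form (P j) (Jbar J K1 K2 j i *m (E i s *m v))
      <= r * quad_form (P i) v.
  have [|r [r01 rP]] := negdefmx_family_contraction Tmin_le_Tmax _ (P_posdef i) (LMI i).
    move=> s; apply: cvg_mulmx; last exact: continuous_expmx.
    by apply: cvg_mulmx; [exact: continuous_expmx | exact: cvg_cst].
  exists r; split => // s v /rP - /(_ v); apply: le_trans.
  rewrite ETr quad_form_congr quad_form_sum le_eqVlt; apply/orP; left; apply/eqP.
  by apply: eq_bigr => j _; rewrite quad_form_congr.
have [c c0 rc] : exists2 c : R, 0 < c & forall i, c <= 1 - r i.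
  by apply: fin_pos_lb => i; have [/andP[_ ri] _] := Hr i; rewrite subr_gt0.
(* One rate for all modes; the minimum with [1] keeps it nonnegative. *)
pose rho := 1 - Num.min c 1.
have rho01 : 0 <= rho < 1.
  by rewrite subr_ge0 ge_min lexx orbT ltrBlDr ltrDl lt_min c0 ltr01.
have r_rho i : r i <= rho.
  have := rc i; have : Num.min c 1 <= c by rewrite ge_min lexx.
  by rewrite /rho; lra.
have /fin_all_exists[mui Hmu] i : exists mu : R, 0 < mu /\
    forall v, mu * `|v| ^+ 2 <= quad_form (P i) v.
  by have [mu ? ?] := posdefmx_ge (P_posdef i); exists mu.
have [mu mu0 muP] : exists2 mu : R, 0 < mu &
    forall i v, mu * `|v| ^+ 2 <= quad_form (P i) v.
  have [mu mu0 muE] : exists2 mu : R, 0 < mu & forall i, mu <= mui i.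
    by apply: fin_pos_lb => i; have [] := Hmu i.
  exists mu => // i v; have [_ /(_ v)] := Hmu i; apply: le_trans.
  by rewrite ler_wpM2r ?exprn_ge0.
have Tmax0 : 0 < Tmax by apply: lt_le_trans Tmin_le_Tmax.
(* The horizon [t 0 + Tmax] covers both the initial interval before [t 0] and any dwell interval. *)
have [CE CE0 EB] := expmx_family_bounded (Abar A B) (addr_ge0 t0_ge0 (ltW Tmax0)).
have [CP CP0 PB] := fin_ub (fun i => `|P i|).
have [CJ CJ0 JB] := fin_ub (fun ij : 'I_N * 'I_N => `|Jbar J K1 K2 ij.1 ij.2|).
pose d : R := (n + m)%:R.
have mul_le (L : 'M[R]_(n + m)) (v : 'cV[R]_(n + m)) C : `|L| <= C ->
    `|L *m v| ^+ 2 <= (d * C) ^+ 2 * `|v| ^+ 2.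
  move=> LC; rewrite -exprMn lerXn2r ?nnegrE ?mulr_ge0 //.
    by apply: le_trans LC.
  apply: le_trans (mx_norm_mulmx _ _) _.
  by rewrite -mulrA ler_wpM2l // ler_wpM2r.
(* [D1] bounds the squared gain of the flow, [G] that of the passage from [chi 0] to the first value
   of the Lyapunov function, and [D2] returns from that value to the state through the lower bound
   [mu]. *)
pose D1 := (d * CE) ^+ 2.
pose G := d ^+ 2 * CP * ((d * CJ) ^+ 2 * D1).
pose D2 := D1 / mu * G.
have D10 : 0 <= D1 by rewrite sqr_ge0.
have D20 : 0 <= D2.
  by rewrite !mulr_ge0 ?sqr_ge0 ?invr_ge0 // ltW.
have t_lt k : t k < t k.+1 by have := dwell_time k; lra.
have t_mono : {homo t : i j / (i <= j)%N >-> i <= j}.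
  by move=> i j ij; rewrite (increasing_seqP _).1.
apply: (@geometric_decay_stable _ _ _ t (D1 + D2) rho) => //.
- exact: (impulse_interval Tmin_gt0 t0_ge0 dwell_time).
- by rewrite addr_ge0.
- move=> _ s [x [u [sigma [traj ->]]]] st.
  rewrite (traj_before_impulses Tmin_gt0 dwell_time traj st).
  have [s0 st'] := andP st.
  apply: le_trans (mul_le _ _ CE _) _; last first.
    by rewrite ler_wpM2r ?sqr_ge0 // lerDl.
  by apply: EB; rewrite s0 (le_trans st') // lerDl ltW.
move=> _ k s [x [u [sigma [traj ->]]]] ks.
pose chi := aug x u.
pose xi k := Jbar J K1 K2 (sigma (t k.+1)) (sigma (t k)) *m chi (t k).
pose V k := quad_form (P (sigma (t k.+1))) (xi k).
have flow := traj_between_impulses Tmin_gt0 t0_ge0 dwell_time traj.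
have V_contract l : V l.+1 <= rho * V l.
  have [_ /(_ (t l.+1 - t l) (xi l) (dwell_time l))] := Hr (sigma (t l.+1)).
  (* Flowing over the whole dwell time turns [xi l] into the state at [t l.+1]. *)
  rewrite -flow ?t_lt ?lexx // => le_r.
  apply: (@le_trans _ _ (r (sigma (t l.+1)) * V l)); last first.
    by rewrite ler_wpM2r // posdefmx_ge0.
  apply: le_trans le_r.
  (* As the weights sum to one, [V l.+1] is its own weighted average; minimality then bounds each
     copy by the candidate [j]. *)
  rewrite -[V l.+1]mul1r -(colsum (sigma (t l.+1))) mulr_suml.
  apply: ler_sum => j _; rewrite ler_wpM2l //.
  exact: (traj_min_jump Tmin_gt0 dwell_time traj).
have V_decay : V k <= rho ^+ k * V 0%N.
  elim: k {ks} => [|k IH]; first by rewrite expr0 mul1r.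
  apply: le_trans (V_contract k) _; rewrite exprS -mulrA ler_wpM2l //.
  by case/andP: rho01.
(* Three gains in turn: the flow up to [t 0], the first impulse, and the form [P]. *)
have V0 : V 0%N <= G * `|chi 0| ^+ 2.
  apply: le_trans (quad_form_le_norm _ _) _.
  rewrite -[leRHS]mulrA; apply: ler_pM; rewrite ?mulr_ge0 ?sqr_ge0 //.
    by rewrite ler_wpM2l ?sqr_ge0 //; exact: PB.
  apply: le_trans (mul_le _ _ CJ (JB (_, _))) _.
  rewrite -[leRHS]mulrA ler_wpM2l ?sqr_ge0 //.
  rewrite /chi (traj_before_impulses Tmin_gt0 dwell_time traj (s := t 0%N)) ?t0_ge0 ?lexx //.
  by apply: mul_le; apply: EB; rewrite t0_ge0 lerDl ltW.
have chi_le : `|chi s| ^+ 2 <= D1 / mu * V k.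
  rewrite /chi (flow _ _ ks).
  apply: (@le_trans _ _ (D1 * `|xi k| ^+ 2)).
    apply: mul_le; apply: EB.
    by have := dwell_time k; move: ks t0_ge0; lra.
  by rewrite -mulrA ler_wpM2l // mulrC ler_pdivlMr // mulrC muP.
apply: le_trans chi_le _.
apply: (@le_trans _ _ (D2 * rho ^+ k * `|chi 0| ^+ 2)); last first.
  rewrite ler_wpM2r ?sqr_ge0 // ler_wpM2r ?lerDr //.
  by rewrite exprn_ge0 //; case/andP: rho01.
have -> : D2 * rho ^+ k * `|chi 0| ^+ 2 =
    D1 / mu * (rho ^+ k * (G * `|chi 0| ^+ 2)) by rewrite /D2; ring.
rewrite ler_wpM2l ?divr_ge0 ?(ltW mu0) //.
apply: le_trans V_decay _.
by rewrite ler_wpM2l // exprn_ge0 //; case/andP: rho01.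
Qed.
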